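(* (The mean value theorem for double Newton integrals) Let $a,b\in\mathbb{R}^2$ with $a<b$ and let $f$ be a double function defined on the double interval $[a,b]$. Suppose that there exists a double primitive function $F$ of $f$ on $[a,b]$. Then there exists $c\in(a,b)$ such that $$\int_a^b f=f(c)(b_1-a_1)(b_2-a_2),$$ where the left-hand side is the double Newton integral of $f$ from $a$ to $b$.
   Context: Points of $\mathbb{R}^2$ are written $a=(a_1,a_2)$. $a<b$ means $a_1<b_1$ and $a_2<b_2$; $a\le b$ means $a_1\le b_1$ and $a_2\le b_2$; $a\nsim b$ means $a_1\ne b_1$ and $a_2\ne b_2$. $[a,b]=\{x\in\mathbb{R}^2:a\le x\le b\}$, $(a,b)=\{x\in\mathbb{R}^2:a<x<b\}$. A double function is a real-valued function $g$ with domain $D(g)\subseteq\mathbb{R}^2$. The double difference is $\Delta_p^x(g)=g(x_1,x_2)-g(x_1,p_2)-g(p_1,x_2)+g(p_1,p_2)$, and for $p\nsim x$, $m_p^x(g)=\Delta_p^x(g)/((x_1-p_1)(x_2-p_2))$. $g$ is double differentiable at $p$ with double derivative $g'(p)\in\mathbb{R}$ if $D(g)$ contains a product of two open intervals containing $p$ and for every $\epsilon>0$ there are $\delta_1,\delta_2>0$ such that for all $x$ with $0<|x_1-p_1|<\delta_1$, $0<|x_2-p_2|<\delta_2$, $m_p^x(g)$ is defined and $|m_p^x(g)-g'(p)|<\epsilon$. For signs $\sigma,\tau\in\{+,-\}$, the $\sigma\tau$-double derivative $g'_{\sigma\tau}(p)$ is defined in the same way, but restricting to those $x$ for which $x_1-p_1$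 has sign $\sigma$ and $x_2-p_2$ has sign $\tau$ (the domain being required to contain $p$ and all points $x$ with $|x_i-p_i|<\delta_i$, $i=1,2$, in the corresponding closed quadrant with vertex $p$, for some $\delta_1,\delta_2>0$). $F:[a,b]\to\mathbb{R}$ is a double primitive function of $f$ on $[a,b]$ if $F'(p)=f(p)$ at each interior point $p$ of $[a,b]$ and, at each boundary point $p$, $F'_{\sigma\tau}(p)$ exists and equals $f(p)$ for every sign pair $\sigma\tau$ for which the corresponding closed quadrant with vertex $p$, intersected with some open rectangle centred at $p$, is contained in $[a,b]$. The double Newton integral is $\int_a^b f:=\Delta_a^b(F)$, which does not depend on the choice of $F$. *)

(* Defs.v *)
From Stdlib Require Import Reals Lra ClassicalEpsilon.
Open Scope R_scope.

Definition point : Type := (R * R)%type.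

Definition dlt (a b : point) : Prop := fst a < fst b /\ snd a < snd b.
Definition dle (a b : point) : Prop := fst a <= fst b /\ snd a <= snd b.
Definition nsim (a b : point) : Prop := fst a <> fst b /\ snd a <> snd b.

Definition closed_dint (a b x : point) : Prop := dle a x /\ dle x b.
Definition open_dint (a b x : point) : Prop := dlt a x /\ dlt x b.

(* A partial function on the plane, encoded as a domain together with a total
   function whose values off the domain are junk and are never used. *)
Record double_function : Type := DoubleFunction {
  ddom : point -> Prop;
  dval :> point -> R
}.

Definition ddiff (p x : point) (g : double_function) : R :=
  g (fst x, snd x) - g (fst x, snd p) - g (fst p, snd x) + g (fst p, snd p).

Definition dmean (p x : point) (g : double_function) : R :=
  ddiff p x g / ((fst x - fst p) * (snd x - snd p)).

Definition dmean_defined (p x : point) (g : double_function) : Prop :=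
  nsim p x /\
  ddom g (fst x, snd x) /\ ddom g (fst x, snd p) /\
  ddom g (fst p, snd x) /\ ddom g (fst p, snd p).

Definition is_double_derivative (g : double_function) (p : point) (l : R) : Prop :=
  (exists u v : point, open_dint u v p /\ forall x, open_dint u v x -> ddom g x) /\
  forall eps : R, 0 < eps -> exists d1 d2 : R, 0 < d1 /\ 0 < d2 /\
    forall x : point,
      0 < Rabs (fst x - fst p) < d1 -> 0 < Rabs (snd x - snd p) < d2 ->
      dmean_defined p x g /\ Rabs (dmean p x g - l) < eps.

Inductive sign : Type := Plus | Minus.

Definition has_sign (s : sign) (t : R) : Prop :=
  match s with Plus => 0 < t | Minus => t < 0 end.

Definition has_weak_sign (s : sign) (t : R) : Prop :=
  match s with Plus => 0 <= t | Minus => t <= 0 end.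

Definition closed_quadrant (s t : sign) (p x : point) : Prop :=
  has_weak_sign s (fst x - fst p) /\ has_weak_sign t (snd x - snd p).

(* [D] contains the part of the closed quadrant with vertex [p] that lies in
   some open rectangle centred at [p]. *)
Definition contains_quadrant_near (s t : sign) (p : point) (D : point -> Prop) : Prop :=
  exists d1 d2 : R, 0 < d1 /\ 0 < d2 /\
    forall x : point, closed_quadrant s t p x ->
      Rabs (fst x - fst p) < d1 -> Rabs (snd x - snd p) < d2 -> D x.

Definition is_signed_double_derivative (s t : sign) (g : double_function)
    (p : point) (l : R) : Prop :=
  contains_quadrant_near s t p (ddom g) /\
  forall eps : R, 0 < eps -> exists d1 d2 : R, 0 < d1 /\ 0 < d2 /\
    forall x : point,
      has_sign s (fst x - fst p) -> has_sign t (snd x - snd p) ->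
      0 < Rabs (fst x - fst p) < d1 -> 0 < Rabs (snd x - snd p) < d2 ->
      dmean_defined p x g /\ Rabs (dmean p x g - l) < eps.

Definition is_double_primitive (F f : double_function) (a b : point) : Prop :=
  (forall x, ddom F x <-> closed_dint a b x) /\
  (forall p, open_dint a b p -> is_double_derivative F p (f p)) /\
  (forall p, closed_dint a b p -> ~ open_dint a b p ->
     forall s t : sign, contains_quadrant_near s t p (closed_dint a b) ->
       is_signed_double_derivative s t F p (f p)).

(* The common value of [ddiff a b F] over all double primitives [F] of [f] on
   [a, b], and an unspecified real if there are none; that all primitives give
   the same value is [double_newton_integralE]. *)
Definition double_newton_integral (f : double_function) (a b : point) : R :=
  epsilon (inhabits 0)
    (fun I => exists F, is_double_primitive F f a b /\ I = ddiff a b F).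

Lemma quadrant_small (F G f : double_function) (a b p : point) (s t : sign) :
  is_double_primitive F f a b -> is_double_primitive G f a b ->
  closed_dint a b p -> forall eps, 0 < eps ->
  exists d, 0 < d /\ forall x, closed_dint a b x ->
    has_sign s (fst x - fst p) -> has_sign t (snd x - snd p) ->
    Rabs (fst x - fst p) < d -> Rabs (snd x - snd p) < d ->
    Rabs (ddiff p x F - ddiff p x G) <=
      eps * (Rabs (fst x - fst p) * Rabs (snd x - snd p)).
Proof.
intros HF HG Hp eps Heps.
destruct (excluded_middle_informative
  (exists y, closed_dint a b y /\ has_sign s (fst y - fst p) /\
     has_sign t (snd y - snd p))) as [[y [Hy [Hys Hyt]]] | Hno].
2:{ exists 1; split; [lra |]; intros x Hx Hs Ht _ _.
    exfalso; apply Hno; exists x; auto. }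
assert (Q : contains_quadrant_near s t p (closed_dint a b)).
{ exists (Rabs (fst y - fst p)), (Rabs (snd y - snd p)).
  unfold closed_quadrant, closed_dint, dle in *.
  destruct Hp as [[? ?] [? ?]], Hy as [[? ?] [? ?]].
  destruct s, t; simpl in Hys, Hyt; simpl;
  (split; [apply Rabs_pos_lt; lra | split; [apply Rabs_pos_lt; lra |]]);
  intros x [? ?];
  unfold Rabs; repeat destruct Rcase_abs; lra. }
assert (S : forall K, is_double_primitive K f a b ->
  exists d1 d2 : R, 0 < d1 /\ 0 < d2 /\ forall x,
    has_sign s (fst x - fst p) -> has_sign t (snd x - snd p) ->
    0 < Rabs (fst x - fst p) < d1 -> 0 < Rabs (snd x - snd p) < d2 ->
    Rabs (dmean p x K - f p) < eps / 2).
{ intros K [_ [Hi Hb]].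
  destruct (excluded_middle_informative (open_dint a b p)) as [Hin | Hout].
  - destruct (proj2 (Hi p Hin) (eps / 2)) as [d1 [d2 [H1 [H2 H]]]]; [lra |].
    exists d1, d2; repeat split; try assumption.
    intros x _ _ X1 X2; apply (H x X1 X2).
  - destruct (proj2 (Hb p Hp Hout s t Q) (eps / 2)) as [d1 [d2 [H1 [H2 H]]]]; [lra |].
    exists d1, d2; repeat split; try assumption.
    intros x X3 X4 X1 X2; apply (H x X3 X4 X1 X2). }
destruct (S F HF) as [d1 [d2 [D1 [D2 HD]]]].
destruct (S G HG) as [e1 [e2 [E1 [E2 HE]]]].
exists (Rmin (Rmin d1 d2) (Rmin e1 e2)); split.
{ repeat apply Rmin_glb_lt; assumption. }
intros x Hx Hs Ht X1 X2.
pose proof (Rmin_l (Rmin d1 d2) (Rmin e1 e2)).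
pose proof (Rmin_r (Rmin d1 d2) (Rmin e1 e2)).
pose proof (Rmin_l d1 d2). pose proof (Rmin_r d1 d2).
pose proof (Rmin_l e1 e2). pose proof (Rmin_r e1 e2).
assert (N1 : fst x - fst p <> 0) by (destruct s; simpl in Hs; lra).
assert (N2 : snd x - snd p <> 0) by (destruct t; simpl in Ht; lra).
pose proof (Rabs_pos_lt _ N1). pose proof (Rabs_pos_lt _ N2).
specialize (HD x Hs Ht ltac:(lra) ltac:(lra)).
specialize (HE x Hs Ht ltac:(lra) ltac:(lra)).
replace (ddiff p x F - ddiff p x G) with
  (((dmean p x F - f p) - (dmean p x G - f p)) *
     ((fst x - fst p) * (snd x - snd p)))
  by (unfold dmean; field; split; assumption).
rewrite !Rabs_mult; apply Rmult_le_compat_r.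
{ apply Rmult_le_pos; apply Rabs_pos. }
unfold Rminus at 1; eapply Rle_trans; [apply Rabs_triang |].
rewrite Rabs_Ropp; lra.
Qed.

Lemma local_small (F G f : double_function) (a b p : point) :
  is_double_primitive F f a b -> is_double_primitive G f a b ->
  closed_dint a b p -> forall eps, 0 < eps ->
  exists d, 0 < d /\ forall x, closed_dint a b x ->
    Rabs (fst x - fst p) < d -> Rabs (snd x - snd p) < d ->
    Rabs (ddiff p x F - ddiff p x G) <=
      eps * (Rabs (fst x - fst p) * Rabs (snd x - snd p)).
Proof.
intros HF HG Hp eps Heps.
destruct (quadrant_small F G f a b p Plus Plus HF HG Hp eps Heps) as [d1 [D1 H1]].
destruct (quadrant_small F G f a b p Plus Minus HF HG Hp eps Heps) as [d2 [D2 H2]].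
destruct (quadrant_small F G f a b p Minus Plus HF HG Hp eps Heps) as [d3 [D3 H3]].
destruct (quadrant_small F G f a b p Minus Minus HF HG Hp eps Heps) as [d4 [D4 H4]].
exists (Rmin (Rmin d1 d2) (Rmin d3 d4)); split.
{ repeat apply Rmin_glb_lt; assumption. }
intros x Hx X1 X2.
pose proof (Rmin_l (Rmin d1 d2) (Rmin d3 d4)).
pose proof (Rmin_r (Rmin d1 d2) (Rmin d3 d4)).
pose proof (Rmin_l d1 d2). pose proof (Rmin_r d1 d2).
pose proof (Rmin_l d3 d4). pose proof (Rmin_r d3 d4).
destruct x as [x y], p as [p q]; simpl in *.
assert (Z : x = p \/ y = q -> Rabs (ddiff (p, q) (x, y) F - ddiff (p, q) (x, y) G)
   <= eps * (Rabs (x - p) * Rabs (y - q))).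
{ intros E. replace (ddiff (p, q) (x, y) F - ddiff (p, q) (x, y) G) with 0
    by (unfold ddiff; simpl; destruct E; subst; ring).
  rewrite Rabs_R0. apply Rmult_le_pos; [lra |].
  apply Rmult_le_pos; apply Rabs_pos. }
destruct (Rtotal_order x p) as [L | [E | L]]; [| apply Z; auto |];
destruct (Rtotal_order y q) as [M | [E | M]]; try (apply Z; auto; fail).
- apply (H4 (x, y)); simpl; auto; lra.
- apply (H3 (x, y)); simpl; auto; lra.
- apply (H2 (x, y)); simpl; auto; lra.
- apply (H1 (x, y)); simpl; auto; lra.
Qed.

Section Bisection.
Variables (D : R -> R -> R -> R -> R).

(* A box is ((left, right), (bottom, top)). *)
Let mid (i : R * R) := (fst i + snd i) / 2.
Let lo (i : R * R) := (fst i, mid i).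
Let hi (i : R * R) := (mid i, snd i).
Let val (B : (R * R) * (R * R)) :=
  Rabs (D (fst (fst B)) (snd (fst B)) (fst (snd B)) (snd (snd B))).

Let next (B : (R * R) * (R * R)) : (R * R) * (R * R) :=
  let (i, j) := B in
  if Rle_dec (val B / 4) (val (lo i, lo j)) then (lo i, lo j) else
  if Rle_dec (val B / 4) (val (lo i, hi j)) then (lo i, hi j) else
  if Rle_dec (val B / 4) (val (hi i, lo j)) then (hi i, lo j) else (hi i, hi j).

Let box (B : (R * R) * (R * R)) (n : nat) := Nat.iter n next B.

Let half (i i' : R * R) := i' = lo i \/ i' = hi i.

Lemma next_half B : half (fst B) (fst (next B)) /\ half (snd B) (snd (next B)).
Proof.
destruct B as [i j]; unfold next, half.
repeat destruct Rle_dec; simpl; auto.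
Qed.

Hypothesis Dadd1 : forall u m v w z, D u v w z = D u m w z + D m v w z.
Hypothesis Dadd2 : forall u v w m z, D u v w z = D u v w m + D u v m z.

Lemma next_val B : val B / 4 <= val (next B).
Proof.
destruct B as [i j]; unfold next.
repeat destruct Rle_dec; try assumption.
unfold val, lo, hi in *; simpl in *.
rewrite (Dadd1 (fst i) (mid i)), (Dadd2 (fst i) (mid i) (fst j) (mid j)),
  (Dadd2 (mid i) (snd i) (fst j) (mid j)) in *.
set (q := D (mid i) (snd i) (mid j) (snd j)) in *.
revert n n0 n1.
unfold Rabs; repeat destruct Rcase_abs; lra.
Qed.

Lemma nested_point (I : nat -> R * R) :
  fst (I O) <= snd (I O) -> (forall n, half (I n) (I (S n))) ->
  exists p, forall n, fst (I n) <= p <= snd (I n).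
Proof.
intros H0 H.
assert (Ord : forall n, fst (I n) <= snd (I n)).
{ induction n as [| n IH]; [exact H0 |].
  destruct (H n) as [E | E]; rewrite E; unfold lo, hi, mid; simpl; lra. }
assert (M : forall n k, fst (I n) <= fst (I (k + n)%nat) /\
   snd (I (k + n)%nat) <= snd (I n)).
{ intros n k; induction k as [| k IH]; [simpl; lra |].
  pose proof (Ord (k + n)%nat); simpl.
  destruct (H (k + n)%nat) as [E | E]; rewrite E; unfold lo, hi, mid; simpl; lra. }
assert (X : forall m n, fst (I m) <= snd (I n)).
{ intros m n. pose proof (M m n). pose proof (M n m). pose proof (Ord (m + n)%nat).
  rewrite (Nat.add_comm n m) in *. lra. }
destruct (completeness (fun x => exists n, x = fst (I n))) as [p [U L]].
- exists (snd (I O)); intros x [n E]; rewrite E; apply X.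
- exists (fst (I O)), O; reflexivity.
- exists p; intros n; split.
  + apply U; exists n; reflexivity.
  + apply L; intros x [m E]; rewrite E; apply X.
Qed.

Lemma half_length (I : nat -> R * R) :
  (forall n, half (I n) (I (S n))) ->
  forall n, snd (I n) - fst (I n) = (snd (I O) - fst (I O)) * (/ 2) ^ n.
Proof.
intros H; induction n as [| n IH]; [simpl; ring |].
replace ((snd (I O) - fst (I O)) * (/ 2) ^ S n)
  with ((snd (I n) - fst (I n)) / 2) by (rewrite IH; simpl; field).
destruct (H n) as [E | E]; rewrite E; unfold lo, hi, mid; simpl; field.
Qed.

Lemma bisection_zero (a1 b1 a2 b2 : R) : a1 < b1 -> a2 < b2 ->
  (forall p q, a1 <= p <= b1 -> a2 <= q <= b2 -> forall eps, 0 < eps ->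
     exists d, 0 < d /\ forall x y, a1 <= x <= b1 -> a2 <= y <= b2 ->
       Rabs (x - p) < d -> Rabs (y - q) < d ->
       Rabs (D p x q y) <= eps * (Rabs (x - p) * Rabs (y - q))) ->
  D a1 b1 a2 b2 = 0.
Proof.
intros H1 H2 HD.
destruct (Req_dec (D a1 b1 a2 b2) 0) as [| NZ]; [assumption | exfalso].
set (B := box ((a1, b1), (a2, b2))).
assert (B0 : B O = ((a1, b1), (a2, b2))) by reflexivity.
assert (h1 : forall n, half (fst (B n)) (fst (B (S n)))) by (intros; apply next_half).
assert (h2 : forall n, half (snd (B n)) (snd (B (S n)))) by (intros; apply next_half).
destruct (nested_point (fun n => fst (B n))) as [p Hp]; [rewrite B0; simpl; lra | exact h1 |].
destruct (nested_point (fun n => snd (B n))) as [q Hq]; [rewrite B0; simpl; lra | exact h2 |].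
pose proof (half_length (fun n => fst (B n)) h1) as l1.
pose proof (half_length (fun n => snd (B n)) h2) as l2.
pose proof (Hp O) as Hp0. pose proof (Hq O) as Hq0. cbv beta in Hp, Hq, Hp0, Hq0, l1, l2.
rewrite B0 in Hp0, Hq0, l1, l2; simpl in Hp0, Hq0, l1, l2.
assert (V : forall n, val (B O) * ((/ 2) ^ n * (/ 2) ^ n) <= val (B n)).
{ induction n as [| n IH]; [rewrite !pow_O; lra |].
  pose proof (next_val (B n)) as K; change (next (B n)) with (B (S n)) in K.
  replace (val (B O) * ((/ 2) ^ S n * (/ 2) ^ S n))
    with (val (B O) * ((/ 2) ^ n * (/ 2) ^ n) / 4) by (rewrite <- !tech_pow_Rmult; field).
  lra. }
set (A := (b1 - a1) * (b2 - a2)).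
assert (PA : 0 < A) by (apply Rmult_lt_0_compat; lra).
assert (PV : 0 < val (B O)) by (apply Rabs_pos_lt; exact NZ).
destruct (HD p q Hp0 Hq0 (val (B O) / (2 * A))) as [d [Pd Hd]].
{ apply Rdiv_lt_0_compat; lra. }
assert (exists n, (b1 - a1) * (/ 2) ^ n < d /\ (b2 - a2) * (/ 2) ^ n < d)
  as [n [N1 N2]].
{ destruct (pow_lt_1_zero (/ 2) ltac:(rewrite Rabs_right; lra)
     (d / (b1 - a1 + (b2 - a2)))) as [n Hn].
  { apply Rdiv_lt_0_compat; lra. }
  exists n. specialize (Hn n (le_n n)).
  assert (0 < (/ 2) ^ n) by (apply pow_lt; lra).
  rewrite Rabs_right in Hn by lra.
  apply Rmult_lt_compat_r with (r := b1 - a1 + (b2 - a2)) in Hn; [| lra].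
  replace (d / (b1 - a1 + (b2 - a2)) * (b1 - a1 + (b2 - a2))) with d in Hn
    by (field; lra).
  assert (0 < (b1 - a1) * (/ 2) ^ n) by (apply Rmult_lt_0_compat; lra).
  assert (0 < (b2 - a2) * (/ 2) ^ n) by (apply Rmult_lt_0_compat; lra).
  lra. }
assert (IN : forall m, a1 <= fst (fst (B m)) /\ snd (fst (B m)) <= b1 /\
                       a2 <= fst (snd (B m)) /\ snd (snd (B m)) <= b2).
{ induction m as [| m IH]; [rewrite B0; simpl; lra |].
  pose proof (Hp m). pose proof (Hq m).
  destruct (h1 m) as [E | E]; destruct (h2 m) as [E' | E']; rewrite E, E';
  unfold lo, hi, mid; simpl; lra. }
specialize (l1 n). specialize (l2 n). specialize (V n). specialize (IN n).
specialize (Hp n). specialize (Hq n).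
unfold val at 2 in V.
set (u := fst (fst (B n))) in *. set (v := snd (fst (B n))) in *.
set (w := fst (snd (B n))) in *. set (z := snd (snd (B n))) in *.
assert (Z1 : forall x y y', D x x y y' = 0)
  by (intros x y y'; pose proof (Dadd1 x x x y y'); lra).
assert (Z2 : forall x x' y, D x x' y y = 0)
  by (intros x x' y; pose proof (Dadd2 x x' y y y); lra).
assert (S : D u v w z = D p v q z - D p u q z - D p v q w + D p u q w).
{ pose proof (Dadd1 p u v q z). pose proof (Dadd1 p u v q w).
  pose proof (Dadd2 u v q w z). lra. }
set (e := val (B O) / (2 * A)) in *.
pose proof (Hd v z ltac:(lra) ltac:(lra) ltac:(rewrite Rabs_right; lra)
  ltac:(rewrite Rabs_right; lra)) as K1.
pose proof (Hd u z ltac:(lra) ltac:(lra) ltac:(rewrite Rabs_left1; lra)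
  ltac:(rewrite Rabs_right; lra)) as K2.
pose proof (Hd v w ltac:(lra) ltac:(lra) ltac:(rewrite Rabs_right; lra)
  ltac:(rewrite Rabs_left1; lra)) as K3.
pose proof (Hd u w ltac:(lra) ltac:(lra) ltac:(rewrite Rabs_left1; lra)
  ltac:(rewrite Rabs_left1; lra)) as K4.
rewrite (Rabs_right (v - p)) in K1, K3 by lra.
rewrite (Rabs_left1 (u - p)) in K2, K4 by lra.
rewrite (Rabs_right (z - q)) in K1, K2 by lra.
rewrite (Rabs_left1 (w - q)) in K3, K4 by lra.
assert (T : Rabs (D u v w z) <= e * ((v - u) * (z - w))).
{ rewrite S.
  replace (e * ((v - u) * (z - w))) with
    (e * ((v - p) * (z - q)) + e * (- (u - p) * (z - q)) +
     e * ((v - p) * - (w - q)) + e * (- (u - p) * - (w - q))) by ring.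
  revert K1 K2 K3 K4; unfold Rabs; repeat destruct Rcase_abs; lra. }
rewrite l1, l2 in T.
replace (e * ((b1 - a1) * (/ 2) ^ n * ((b2 - a2) * (/ 2) ^ n)))
  with (val (B O) * ((/ 2) ^ n * (/ 2) ^ n) / 2) in T
  by (unfold e, A; field; split; lra).
assert (0 < (/ 2) ^ n) by (apply pow_lt; lra).
assert (0 < val (B O) * ((/ 2) ^ n * (/ 2) ^ n))
  by (apply Rmult_lt_0_compat; [assumption | apply Rmult_lt_0_compat; assumption]).
lra.
Qed.

End Bisection.

Lemma double_newton_integralE (F f : double_function) (a b : point) :
  dlt a b -> is_double_primitive F f a b ->
  double_newton_integral f a b = ddiff a b F.
Proof.
intros [L1 L2] HF; unfold double_newton_integral.
match goal with |- epsilon ?i ?P = _ => 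
  destruct (epsilon_spec i P) as [G [HG E]] end.
{ exists (ddiff a b F), F; auto. }
rewrite E; clear E.
apply Rminus_diag_uniq.
apply (bisection_zero (fun x x' y y' => ddiff (x, y) (x', y') G - ddiff (x, y) (x', y') F)
   ltac:(intros; unfold ddiff; simpl; ring) ltac:(intros; unfold ddiff; simpl; ring)
   (fst a) (fst b) (snd a) (snd b) L1 L2).
intros p q Hp Hq eps Heps.
destruct (local_small G F f a b (p, q) HG HF) with (eps := eps) as [d [Pd Hd]];
  [split; split; simpl; lra | exact Heps |].
exists d; split; [exact Pd |]; intros x y Hx Hy X Y.
apply (Hd (x, y)); simpl; auto.
split; split; simpl; lra.
Qed.

(* Main.v *)
Require Import Defs.
From Stdlib Require Import Reals.
From Stdlib Require Import Lra Classical ClassicalEpsilon.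
Open Scope R_scope.

(** The double difference [D] of a double primitive is additive in each pair of
    variables.  Covering a segment by finitely many neighbourhoods on which the
    derivative controls [D] shows that [D] is continuous in the horizontal
    variable, and likewise in the vertical one.  The universal chord theorem
    with ratio 1/3, applied horizontally and then vertically, therefore yields
    a rectangle strictly inside the given one, of one third of its side
    lengths, with the same mean.  Iterating, the nested rectangles shrink to an
    interior point, at which the double derivative must be the common mean. *)

(** * Connectedness of segments and the chord theorem *)

(* An equivalence relation with open classes on a segment has one class; this
   serves both as a compactness argument and as the intermediate value theorem. *)
Lemma segment_connected (P : R -> R -> Prop) (a b : R) :
  a <= b ->
  (forall x y, P x y -> P y x) -> (forall x y z, P x y -> P y z -> P x z) ->
  (forall x, a <= x <= b -> exists d, 0 < d /\
     forall y, a <= y <= b -> Rabs (y - x) < d -> P x y) ->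
  P a b.
Proof.
intros Hab Psym Ptrans Ploc.
destruct (completeness (fun x => a <= x <= b /\ P a x)) as [s [U L]].
- exists b; intros x [Hx _]; lra.
- exists a; split; [lra |].
  destruct (Ploc a) as [d [Pd Hd]]; [lra |].
  apply Hd; [lra |]. rewrite Rminus_diag, Rabs_R0; exact Pd.
- assert (Hs : a <= s <= b).
  { split.
    - apply U; split; [lra |].
      destruct (Ploc a) as [d [Pd Hd]]; [lra |].
      apply Hd; [lra |]. rewrite Rminus_diag, Rabs_R0; exact Pd.
    - apply L; intros x [Hx _]; lra. }
  destruct (Ploc s Hs) as [d [Pd Hd]].
  assert (exists y, (a <= y <= b /\ P a y) /\ s - d < y) as [y [[Hy Py] Hys]].
  { apply NNPP; intros N.
    assert (s <= s - d); [| lra].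
    apply L; intros x Hx; apply Rnot_lt_le; intros Hx'.
    apply N; exists x; auto. }
  assert (y <= s) by (apply U; auto).
  assert (Pas : P a s).
  { apply Ptrans with y; [exact Py |]. apply Psym, Hd; [exact Hy |].
    rewrite Rabs_left1; lra. }
  (* This point lies in the class of [a], so it cannot exceed the supremum [s]; hence [s] is [b]. *)
  assert (M : Rmin b (s + d / 2) <= s).
  { pose proof (Rmin_l b (s + d / 2)). pose proof (Rmin_r b (s + d / 2)).
    assert (s <= Rmin b (s + d / 2)) by (apply Rmin_glb; lra).
    apply U; split; [lra |]. apply Ptrans with s; [exact Pas |].
    apply Hd; [lra |]. rewrite Rabs_right; lra. }
  replace b with s; [exact Pas |].
  revert M; unfold Rmin; destruct Rle_dec; lra.
Qed.

Definition continuous_on_segment (h : R -> R) (a b : R) : Prop :=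
  forall x, a <= x <= b -> forall eps, 0 < eps -> exists d, 0 < d /\
    forall y, a <= y <= b -> Rabs (y - x) < d -> Rabs (h y - h x) < eps.

(** If [h] had no zero, having the same sign would be a relation with open classes: values within
    [Rabs (h x)] of [h x] share its sign. Connectedness would then give the endpoints equal
    signs. *)
Lemma segment_zero (h : R -> R) (a b : R) :
  a <= b -> continuous_on_segment h a b -> h a * h b < 0 ->
  exists t, a < t < b /\ h t = 0.
Proof.
intros Hab Hc Hs. apply NNPP; intros N.
assert (NZ : forall t, a <= t <= b -> h t <> 0).
{ intros t Ht E.
  destruct (Req_dec t a) as [-> | ?]; [rewrite E in Hs; lra |].
  destruct (Req_dec t b) as [-> | ?]; [rewrite E in Hs; lra |].
  apply N; exists t; split; [lra | exact E]. }
assert (S : h a < 0 <-> h b < 0).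
{ apply (segment_connected (fun x y => h x < 0 <-> h y < 0)); try tauto.
  intros x Hx.
  destruct (Hc x Hx (Rabs (h x))) as [d [Pd Hd]].
  { apply Rabs_pos_lt; auto. }
  exists d; split; [exact Pd |]; intros y Hy Hxy.
  specialize (Hd y Hy Hxy); revert Hd.
  unfold Rabs; repeat destruct Rcase_abs; lra. }
pose proof (NZ a ltac:(lra)). pose proof (NZ b ltac:(lra)).
destruct (Rlt_dec (h a) 0) as [Ha | Ha].
- assert (h b < 0) by tauto.
  pose proof (Rmult_lt_0_compat (- h a) (- h b)); lra.
- assert (~ h b < 0) by tauto.
  pose proof (Rmult_lt_0_compat (h a) (h b)); lra.
Qed.

(** The increments over the three consecutive thirds add up to the total, so their deviations [k]
    from the average sum to zero and [k] vanishes somewhere. That the chord avoids both endpoints is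
    what later makes the mean value point interior. *)
Lemma third_chord (h : R -> R) (a b : R) :
  a < b -> continuous_on_segment h a b ->
  exists u v, a < u /\ v < b /\ v - u = (b - a) / 3 /\
    h v - h u = (h b - h a) / 3.
Proof.
intros Hab Hc.
set (l := (b - a) / 3).
set (k := fun t => h (t + l) - h t - (h b - h a) / 3).
assert (Hl : 0 < l) by (unfold l; lra).
assert (El : b = a + l + l + l) by (unfold l; lra).
assert (Kc : continuous_on_segment k a (a + l + l)).
{ intros x Hx eps Heps.
  destruct (Hc x ltac:(lra) (eps / 2) ltac:(lra)) as [d [Pd Hd]].
  destruct (Hc (x + l) ltac:(lra) (eps / 2) ltac:(lra)) as [e [Pe He]].
  exists (Rmin d e); split; [apply Rmin_glb_lt; assumption |].
  intros y Hy Hxy.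
  pose proof (Rmin_l d e). pose proof (Rmin_r d e).
  specialize (Hd y ltac:(lra) ltac:(lra)).
  specialize (He (y + l) ltac:(lra)
    ltac:(replace (y + l - (x + l)) with (y - x) by ring; lra)).
  apply Rabs_def2 in Hd, He. unfold k; apply Rabs_def1; lra. }
assert (K3 : k a + k (a + l) + k (a + l + l) = 0).
{ unfold k; rewrite El; lra. }
assert (exists t, a < t < a + l + l /\ k t = 0) as [t [Ht Kt]].
{ destruct (Req_dec (k (a + l)) 0) as [Z | NZ].
  { exists (a + l); split; [lra | exact Z]. }
  assert (Sub : forall x y, a <= x -> y <= a + l + l ->
    continuous_on_segment k x y).
  { intros x y X Y z Hz eps Heps.
    destruct (Kc z ltac:(lra) eps Heps) as [d [Pd Hd]].
    exists d; split; [exact Pd |]; intros; apply Hd; lra. }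
  assert (Sq : 0 < k (a + l) * k (a + l)) by (apply Rsqr_pos_lt; exact NZ).
  (* The two products add up to minus the square of [k (a + l)], so at least one is negative. *)
  assert (k a * k (a + l) < 0 \/ k (a + l) * k (a + l + l) < 0) as [S | S].
  { replace (k (a + l + l)) with (- k a - k (a + l)) by lra.
    destruct (Rlt_dec (k a * k (a + l)) 0); [tauto | right; lra]. }
  - destruct (segment_zero k a (a + l)) as [t [Ht E]];
      [lra | apply Sub; lra | exact S | exists t; split; [lra | exact E]].
  - destruct (segment_zero k (a + l) (a + l + l)) as [t [Ht E]];
      [lra | apply Sub; lra | exact S | exists t; split; [lra | exact E]]. }
exists t, (t + l); unfold k in Kt; repeat split; lra.
Qed.

Lemma nested_segments (u v : nat -> R) :
  (forall n, u n <= u (S n)) -> (forall n, v (S n) <= v n) ->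
  (forall n, u n <= v n) -> exists c, forall n, u n <= c <= v n.
Proof.
intros Hu Hv Huv.
assert (X : forall m n, u m <= v n).
{ intros m n.
  assert (u m <= u (m + n)%nat) by (apply tech9; [exact Hu | apply Nat.le_add_r]).
  assert (v (m + n)%nat <= v n).
  { apply decreasing_prop; [exact Hv |].
    rewrite Nat.add_comm; apply Nat.le_add_r. }
  pose proof (Huv (m + n)%nat); lra. }
destruct (completeness (fun x => exists n, x = u n)) as [c [U L]].
- exists (v O); intros x [n ->]; apply X.
- exists (u O), O; reflexivity.
- exists c; intros n; split; [apply U; exists n; reflexivity |].
  apply L; intros x [m ->]; apply X.
Qed.

(** * Additive rectangle functions and their derivatives *)

(** The equations range over reals in any order, which forces [0] on degenerate rectangles and a
    change of sign when opposite sides are exchanged. *)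
Definition additive_rect (D : R -> R -> R -> R -> R) : Prop :=
  (forall u m v w z, D u v w z = D u m w z + D m v w z) /\
  (forall u v w m z, D u v w z = D u v w m + D u v m z).

(** Multiplying out the quotient makes the bound meaningful on the lines [x = p] and [y = q] too.
    Restricting [x], [y] to the closed rectangle treats two-sided derivatives inside and signed ones
    on the boundary uniformly. *)
Definition rect_derivative (D : R -> R -> R -> R -> R) (g : R -> R -> R)
    (a1 b1 a2 b2 : R) : Prop :=
  forall p q, a1 <= p <= b1 -> a2 <= q <= b2 -> forall eps, 0 < eps ->
    exists d, 0 < d /\ forall x y, a1 <= x <= b1 -> a2 <= y <= b2 ->
      Rabs (x - p) < d -> Rabs (y - q) < d ->
      Rabs (D p x q y - g p q * ((x - p) * (y - q))) <=
        eps * (Rabs (x - p) * Rabs (y - q)).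

(** Exchanging the axes lets the horizontal results serve vertically. *)
Lemma rect_swap D g a1 b1 a2 b2 :
  additive_rect D -> rect_derivative D g a1 b1 a2 b2 ->
  additive_rect (fun u v w z => D w z u v) /\
  rect_derivative (fun u v w z => D w z u v) (fun p q => g q p) a2 b2 a1 b1.
Proof.
intros [A1 A2] HD; split; [split; intros; auto |].
intros p q Hp Hq eps Heps.
destruct (HD q p Hq Hp eps Heps) as [d [Pd Hd]].
exists d; split; [exact Pd |]; intros x y Hx Hy X Y.
rewrite (Rmult_comm (x - p)), (Rmult_comm (Rabs (x - p))); auto.
Qed.

(** Fix [x] and relate two heights [q], [r] when [D a1 t q r] is continuous in [t] at [x].
    Additivity makes this symmetric and transitive, and the derivative at [(x, q)] makes its classes
    open, so [w] and [z] are related. *)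
Lemma rect_derivative_continuous D g a1 b1 a2 b2 w z :
  additive_rect D -> rect_derivative D g a1 b1 a2 b2 ->
  a2 <= w -> w <= z -> z <= b2 ->
  continuous_on_segment (fun t => D a1 t w z) a1 b1.
Proof.
intros [A1 A2] HD Hw Hwz Hz x Hx.
assert (Z2 : forall x x' y, D x x' y y = 0)
  by (intros x0 x' y; pose proof (A2 x0 x' y y y); lra).
apply (segment_connected (fun w z => forall eps, 0 < eps -> exists d, 0 < d /\
  forall y, a1 <= y <= b1 -> Rabs (y - x) < d ->
    Rabs (D a1 y w z - D a1 x w z) < eps)); [exact Hwz | | |].
- intros q r H eps Heps.
  destruct (H eps Heps) as [d [Pd Hd]].
  exists d; split; [exact Pd |]; intros y Hy Hxy.
  specialize (Hd y Hy Hxy).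
  pose proof (A2 a1 y q r q) as Ey. pose proof (A2 a1 x q r q) as Ex.
  rewrite Z2 in Ey, Ex.
  apply Rabs_def2 in Hd; apply Rabs_def1; lra.
- intros q r s H H' eps Heps.
  destruct (H (eps / 2) ltac:(lra)) as [d [Pd Hd]].
  destruct (H' (eps / 2) ltac:(lra)) as [e [Pe He]].
  exists (Rmin d e); split; [apply Rmin_glb_lt; assumption |].
  intros y Hy Hxy.
  pose proof (Rmin_l d e). pose proof (Rmin_r d e).
  specialize (Hd y Hy ltac:(lra)). specialize (He y Hy ltac:(lra)).
  rewrite (A2 a1 y q r s), (A2 a1 x q r s).
  apply Rabs_def2 in Hd, He. apply Rabs_def1; lra.
- intros q Hq.
  destruct (HD x q Hx ltac:(lra) 1 ltac:(lra)) as [d [Pd Hd]].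
  exists d; split; [exact Pd |]; intros r Hr Hqr eps Heps.
  (* With tolerance 1 in the derivative and [Rabs (r - q) < d], [C] is a Lipschitz constant at
     [x]. *)
  set (C := (Rabs (g x q) + 1) * d).
  assert (PC : 0 < C).
  { apply Rmult_lt_0_compat; [pose proof (Rabs_pos (g x q)); lra | exact Pd]. }
  assert (0 < eps / C) by (apply Rdiv_lt_0_compat; assumption).
  exists (Rmin d (eps / C)); split; [apply Rmin_glb_lt; assumption |].
  intros y Hy Hxy.
  pose proof (Rmin_l d (eps / C)). pose proof (Rmin_r d (eps / C)).
  specialize (Hd y r Hy ltac:(lra) ltac:(lra) Hqr).
  replace (D a1 y q r - D a1 x q r) with (D x y q r)
    by (rewrite (A1 a1 x y); ring).
  apply Rle_lt_trans with (C * Rabs (y - x)).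
  + replace (D x y q r) with ((D x y q r - g x q * ((y - x) * (r - q)))
      + g x q * ((y - x) * (r - q))) by ring.
    eapply Rle_trans; [apply Rabs_triang |].
    rewrite !Rabs_mult.
    apply Rle_trans with
      ((Rabs (g x q) + 1) * Rabs (y - x) * Rabs (r - q)); [lra |].
    replace (C * Rabs (y - x)) with ((Rabs (g x q) + 1) * Rabs (y - x) * d)
      by (unfold C; ring).
    apply Rmult_le_compat_l; [| lra].
    apply Rmult_le_pos; [| apply Rabs_pos].
    pose proof (Rabs_pos (g x q)); lra.
  + replace eps with (C * (eps / C)) by (field; lra).
    apply Rmult_lt_compat_l; lra.
Qed.

Lemma rect_third D g a1 b1 a2 b2 w z :
  additive_rect D -> rect_derivative D g a1 b1 a2 b2 ->
  a1 < b1 -> a2 <= w -> w <= z -> z <= b2 ->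
  exists u v, a1 < u /\ v < b1 /\ v - u = (b1 - a1) / 3 /\
    D u v w z = D a1 b1 w z / 3.
Proof.
intros A HD H1 Hw Hwz Hz.
destruct (third_chord (fun t => D a1 t w z) a1 b1 H1) as [u [v [Hu [Hv [L E]]]]].
{ eapply rect_derivative_continuous; eassumption. }
destruct A as [A1 A2].
exists u, v; repeat split; try assumption.
(* The second instance gives [D a1 a1 w z = 0], so the total increment is [D a1 b1 w z]. *)
pose proof (A1 a1 u v w z). pose proof (A1 a1 a1 a1 w z). lra.
Qed.

Lemma rect_derivative_sub D g a1 b1 a2 b2 u v w z :
  rect_derivative D g a1 b1 a2 b2 ->
  a1 <= u -> v <= b1 -> a2 <= w -> z <= b2 -> rect_derivative D g u v w z.
Proof.
intros HD Hu Hv Hw Hz p q Hp Hq eps Heps.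
destruct (HD p q ltac:(lra) ltac:(lra) eps Heps) as [d [Pd Hd]].
exists d; split; [exact Pd |]; intros; apply Hd; lra.
Qed.

(** * Nested thirds and the mean value theorem for rectangle functions *)

Record rect : Type := Rect { xmin : R; xmax : R; ymin : R; ymax : R }.

Definition rect_diff (D : R -> R -> R -> R -> R) (B : rect) : R :=
  D (xmin B) (xmax B) (ymin B) (ymax B).

Definition rect_proper (B : rect) : Prop := xmin B < xmax B /\ ymin B < ymax B.

(** Area and difference both shrink by the factor 9, so the mean is preserved. *)
Definition third_inside (D : R -> R -> R -> R -> R) (B B' : rect) : Prop :=
  (xmin B < xmin B' /\ xmax B' < xmax B) /\
  (ymin B < ymin B' /\ ymax B' < ymax B) /\
  xmax B' - xmin B' = (xmax B - xmin B) / 3 /\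
  ymax B' - ymin B' = (ymax B - ymin B) / 3 /\
  rect_diff D B' = rect_diff D B / 9.

Lemma third_inside_exists D g B :
  additive_rect D ->
  rect_derivative D g (xmin B) (xmax B) (ymin B) (ymax B) -> rect_proper B ->
  exists B', third_inside D B B'.
Proof.
destruct B as [a1 b1 a2 b2]; unfold rect_proper; simpl; intros A HD [H1 H2].
destruct (rect_third D g a1 b1 a2 b2 a2 b2 A HD H1) as [u [v [Hu [Hv [Luv E]]]]];
  try lra.
destruct (rect_swap D g a1 b1 a2 b2 A HD) as [A' HD'].
(* The strip over [[u, v]] is cut vertically, so the two factors 1/3 multiply to 1/9. *)
destruct (rect_third _ _ a2 b2 a1 b1 u v A' HD' H2) as [w [z [Hw [Hz [Lwz E']]]]];
  try lra.
exists (Rect u v w z); unfold third_inside, rect_diff; simpl.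
repeat split; lra.
Qed.

Lemma third_sequence D g B0 :
  additive_rect D ->
  rect_derivative D g (xmin B0) (xmax B0) (ymin B0) (ymax B0) ->
  rect_proper B0 ->
  exists B : nat -> rect, B O = B0 /\ forall n, third_inside D (B n) (B (S n)).
Proof.
intros A HD H0.
(* This invariant supplies what [third_inside_exists] needs for the next choice: a proper rectangle
   on which the derivative is still available. *)
set (inside := fun B => xmin B0 <= xmin B /\ xmax B <= xmax B0 /\
  ymin B0 <= ymin B /\ ymax B <= ymax B0 /\ rect_proper B).
set (next := fun B => epsilon (inhabits B0) (third_inside D B)).
assert (N : forall B, inside B -> third_inside D B (next B)).
{ intros B [? [? [? [? ?]]]]; apply epsilon_spec.
  apply third_inside_exists with g; try assumption.
  eapply rect_derivative_sub; eassumption. }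
set (B := fun n => Nat.iter n next B0).
assert (I : forall n, inside (B n)).
{ induction n as [| n IH].
  - repeat split; simpl; try apply Rle_refl; apply H0.
  - change (B (S n)) with (next (B n)).
    destruct (N _ IH) as [? [? [? [? _]]]].
    destruct IH as [? [? [? [? [? ?]]]]].
    unfold inside, rect_proper; repeat split; lra. }
exists B; split; [reflexivity |]; intros n; apply N, I.
Qed.

(** A two-dimensional straddle lemma: [(p, q)] splits the rectangle into four with a corner there,
    and the four errors and areas add up. *)
Lemma rect_derivative_around D g a1 b1 a2 b2 p q :
  additive_rect D -> rect_derivative D g a1 b1 a2 b2 ->
  a1 <= p <= b1 -> a2 <= q <= b2 -> forall eps, 0 < eps ->
  exists d, 0 < d /\ forall u v w z,
    a1 <= u <= p -> p <= v <= b1 -> a2 <= w <= q -> q <= z <= b2 ->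
    v - u < d -> z - w < d ->
    Rabs (D u v w z - g p q * ((v - u) * (z - w))) <= eps * ((v - u) * (z - w)).
Proof.
intros [A1 A2] HD Hp Hq eps Heps.
destruct (HD p q Hp Hq eps Heps) as [d [Pd Hd]].
exists d; split; [exact Pd |]; intros u v w z Hu Hv Hw Hz L1 L2.
assert (S : D u v w z = D p v q z - D p u q z - D p v q w + D p u q w).
{ pose proof (A1 p u v q z). pose proof (A1 p u v q w).
  pose proof (A2 u v q w z). lra. }
pose proof (Hd v z ltac:(lra) ltac:(lra) ltac:(rewrite Rabs_right; lra)
  ltac:(rewrite Rabs_right; lra)) as K1.
pose proof (Hd u z ltac:(lra) ltac:(lra) ltac:(rewrite Rabs_left1; lra)
  ltac:(rewrite Rabs_right; lra)) as K2.
pose proof (Hd v w ltac:(lra) ltac:(lra) ltac:(rewrite Rabs_right; lra)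
  ltac:(rewrite Rabs_left1; lra)) as K3.
pose proof (Hd u w ltac:(lra) ltac:(lra) ltac:(rewrite Rabs_left1; lra)
  ltac:(rewrite Rabs_left1; lra)) as K4.
rewrite (Rabs_right (v - p)) in K1, K3 by lra.
rewrite (Rabs_left1 (u - p)) in K2, K4 by lra.
rewrite (Rabs_right (z - q)) in K1, K2 by lra.
rewrite (Rabs_left1 (w - q)) in K3, K4 by lra.
revert K1 K2 K3 K4; rewrite S.
unfold Rabs; repeat destruct Rcase_abs; lra.
Qed.

Lemma rect_mean_value D g a1 b1 a2 b2 :
  additive_rect D -> rect_derivative D g a1 b1 a2 b2 -> a1 < b1 -> a2 < b2 ->
  exists p q, a1 < p < b1 /\ a2 < q < b2 /\
    D a1 b1 a2 b2 = g p q * ((b1 - a1) * (b2 - a2)).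
Proof.
intros A HD H1 H2.
destruct (third_sequence D g (Rect a1 b1 a2 b2) A HD (conj H1 H2)) as [B [B0 HB]].
assert (L : forall n,
  xmax (B n) - xmin (B n) = (b1 - a1) * (/ 3) ^ n /\
  ymax (B n) - ymin (B n) = (b2 - a2) * (/ 3) ^ n /\
  rect_diff D (B n) = D a1 b1 a2 b2 * ((/ 3) ^ n * (/ 3) ^ n)).
{ induction n as [| n [IH1 [IH2 IH3]]].
  - rewrite B0; unfold rect_diff; simpl; repeat split; ring.
  - destruct (HB n) as [_ [_ [E1 [E2 E3]]]].
    rewrite E1, E2, E3, IH1, IH2, IH3, <- !tech_pow_Rmult.
    repeat split; field. }
assert (Pw : forall n, 0 < (/ 3) ^ n) by (intros; apply pow_lt; lra).
assert (P1 : forall n, 0 < (b1 - a1) * (/ 3) ^ n)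
  by (intros; apply Rmult_lt_0_compat; [lra | apply Pw]).
assert (P2 : forall n, 0 < (b2 - a2) * (/ 3) ^ n)
  by (intros; apply Rmult_lt_0_compat; [lra | apply Pw]).
destruct (nested_segments (fun n => xmin (B n)) (fun n => xmax (B n))) as [p Hp];
  try (intros n; destruct (HB n) as [? [? _]]; destruct (L n); specialize (P1 n); lra).
destruct (nested_segments (fun n => ymin (B n)) (fun n => ymax (B n))) as [q Hq];
  try (intros n; destruct (HB n) as [? [? _]]; destruct (L n) as [_ [? _]];
       specialize (P2 n); lra).
cbv beta in Hp, Hq.
assert (In : forall n, a1 <= xmin (B n) /\ xmax (B n) <= b1 /\
  a2 <= ymin (B n) /\ ymax (B n) <= b2).
{ induction n as [| n IH]; [rewrite B0; simpl; lra |].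
  destruct (HB n) as [? [? _]]; lra. }
(* [B 1] lies strictly inside the original rectangle and contains [(p, q)], which is therefore
   interior. *)
destruct (HB O) as [I1 [I2 _]]; rewrite B0 in I1, I2; simpl in I1, I2.
pose proof (Hp 1%nat). pose proof (Hq 1%nat).
exists p, q; split; [lra |]; split; [lra |].
set (m := D a1 b1 a2 b2) in *. set (S := (b1 - a1) * (b2 - a2)).
assert (PS : 0 < S) by (apply Rmult_lt_0_compat; lra).
apply cond_eq; intros eps Heps.
(* On [B n], difference and area are [m] and [S] times the same [r]. Cancelling [r] leaves the error
   [eps / (2 * S) * S], that is [eps / 2]. *)
destruct (rect_derivative_around D g a1 b1 a2 b2 p q A HD ltac:(lra) ltac:(lra)
  (eps / (2 * S))) as [d [Pd Hd]].
{ apply Rdiv_lt_0_compat; lra. }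
assert (exists n, (b1 - a1) * (/ 3) ^ n < d /\ (b2 - a2) * (/ 3) ^ n < d)
  as [n [N1 N2]].
{ destruct (pow_lt_1_zero (/ 3) ltac:(rewrite Rabs_right; lra)
    (d / (b1 - a1 + (b2 - a2)))) as [n Hn].
  { apply Rdiv_lt_0_compat; lra. }
  exists n; specialize (Hn n (le_n n)).
  rewrite Rabs_right in Hn by (apply Rle_ge, Rlt_le, Pw).
  apply Rmult_lt_compat_r with (r := b1 - a1 + (b2 - a2)) in Hn; [| lra].
  replace (d / (b1 - a1 + (b2 - a2)) * (b1 - a1 + (b2 - a2))) with d in Hn
    by (field; lra).
  specialize (P1 n); specialize (P2 n); lra. }
specialize (In n); specialize (Hp n); specialize (Hq n).
destruct (L n) as [L1 [L2 L3]].
specialize (Hd (xmin (B n)) (xmax (B n)) (ymin (B n)) (ymax (B n))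
  ltac:(lra) ltac:(lra) ltac:(lra) ltac:(lra) ltac:(lra) ltac:(lra)).
unfold rect_diff in L3; rewrite L1, L2, L3 in Hd.
set (r := (/ 3) ^ n * (/ 3) ^ n) in *.
assert (Pr : 0 < r) by (apply Rmult_lt_0_compat; apply Pw).
replace (m * r - g p q * ((b1 - a1) * (/ 3) ^ n * ((b2 - a2) * (/ 3) ^ n)))
  with ((m - g p q * S) * r) in Hd by (unfold S, r; ring).
replace (eps / (2 * S) * ((b1 - a1) * (/ 3) ^ n * ((b2 - a2) * (/ 3) ^ n)))
  with (eps / 2 * r) in Hd by (unfold S, r; field; lra).
rewrite Rabs_mult, (Rabs_right r) in Hd by lra.
apply Rmult_le_reg_r in Hd; [lra | exact Pr].
Qed.

(** * From double primitives to rectangle functions *)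

(** The box contains the whole rectangle spanned by [p] and [y], whose side lengths serve as the two
    radii. *)
Lemma contains_quadrant_near_box (a b p y : point) (s t : sign) :
  closed_dint a b p -> closed_dint a b y ->
  has_sign s (fst y - fst p) -> has_sign t (snd y - snd p) ->
  contains_quadrant_near s t p (closed_dint a b).
Proof.
unfold contains_quadrant_near, closed_quadrant, closed_dint, dle.
intros [[? ?] [? ?]] [[? ?] [? ?]] Hs Ht.
exists (Rabs (fst y - fst p)), (Rabs (snd y - snd p)).
destruct s, t; simpl in Hs, Ht; simpl;
(split; [apply Rabs_pos_lt; lra | split; [apply Rabs_pos_lt; lra |]]);
intros x [? ?]; unfold Rabs; repeat destruct Rcase_abs; lra.
Qed.

(** Interior and boundary points are merged here. A quadrant that meets the box only along its sides
    makes the claim vacuous; any other one admits a derivative, two-sided or signed. *)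
Lemma double_primitive_quadrant (F f : double_function) (a b p : point) (s t : sign) :
  is_double_primitive F f a b -> closed_dint a b p -> forall eps, 0 < eps ->
  exists d, 0 < d /\ forall x, closed_dint a b x ->
    has_sign s (fst x - fst p) -> has_sign t (snd x - snd p) ->
    Rabs (fst x - fst p) < d -> Rabs (snd x - snd p) < d ->
    Rabs (dmean p x F - f p) < eps.
Proof.
intros [_ [Hi Hb]] Hp eps Heps.
destruct (classic (exists y, closed_dint a b y /\ has_sign s (fst y - fst p) /\
  has_sign t (snd y - snd p))) as [[y [Hy [Ys Yt]]] | N].
2:{ exists 1; split; [lra |]; intros x Hx Xs Xt; exfalso; eauto. }
assert (exists d1 d2, 0 < d1 /\ 0 < d2 /\ forall x,
  has_sign s (fst x - fst p) -> has_sign t (snd x - snd p) ->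
  0 < Rabs (fst x - fst p) < d1 -> 0 < Rabs (snd x - snd p) < d2 ->
  Rabs (dmean p x F - f p) < eps) as [d1 [d2 [P1 [P2 H]]]].
{ destruct (classic (open_dint a b p)) as [Ip | Bp].
  - destruct (proj2 (Hi p Ip) eps Heps) as [d1 [d2 [P1 [P2 H]]]].
    exists d1, d2; repeat split; try assumption; intros; apply H; assumption.
  - destruct (proj2 (Hb p Hp Bp s t
      (contains_quadrant_near_box a b p y s t Hp Hy Ys Yt)) eps Heps)
      as [d1 [d2 [P1 [P2 H]]]].
    exists d1, d2; repeat split; try assumption; intros; apply H; assumption. }
exists (Rmin d1 d2); split; [apply Rmin_glb_lt; assumption |].
intros x _ Xs Xt X1 X2.
pose proof (Rmin_l d1 d2). pose proof (Rmin_r d1 d2).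
apply H; try assumption; (split; [apply Rabs_pos_lt | lra]).
- destruct s; simpl in Xs; lra.
- destruct t; simpl in Xt; lra.
Qed.

Lemma sign_exists (r : R) : r <> 0 -> exists s, has_sign s r.
Proof.
intros H; destruct (Rlt_dec 0 r); [exists Plus | exists Minus]; simpl; lra.
Qed.

Lemma double_primitive_rect_derivative (F f : double_function) (a b : point) :
  is_double_primitive F f a b ->
  rect_derivative (fun u v w z => ddiff (u, w) (v, z) F) (fun p q => f (p, q))
    (fst a) (fst b) (snd a) (snd b).
Proof.
intros HF p q Hp Hq eps Heps.
assert (Hpq : closed_dint a b (p, q)) by (split; split; simpl; lra).
assert (exists d, 0 < d /\ forall s t x, closed_dint a b x ->
  has_sign s (fst x - p) -> has_sign t (snd x - q) ->
  Rabs (fst x - p) < d -> Rabs (snd x - q) < d ->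
  Rabs (dmean (p, q) x F - f (p, q)) < eps) as [d [Pd Hd]].
{ pose proof (fun s t => double_primitive_quadrant F f a b (p, q) s t HF Hpq eps Heps)
    as Q.
  destruct (Q Plus Plus) as [d1 [P1 H1]]. destruct (Q Plus Minus) as [d2 [P2 H2]].
  destruct (Q Minus Plus) as [d3 [P3 H3]]. destruct (Q Minus Minus) as [d4 [P4 H4]].
  exists (Rmin (Rmin d1 d2) (Rmin d3 d4)); split.
  { repeat apply Rmin_glb_lt; assumption. }
  pose proof (Rmin_l (Rmin d1 d2) (Rmin d3 d4)).
  pose proof (Rmin_r (Rmin d1 d2) (Rmin d3 d4)).
  pose proof (Rmin_l d1 d2). pose proof (Rmin_r d1 d2).
  pose proof (Rmin_l d3 d4). pose proof (Rmin_r d3 d4).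
  intros [|] [|] x Hx Xs Xt X1 X2;
    [apply H1 | apply H2 | apply H3 | apply H4]; simpl; try assumption; lra. }
exists d; split; [exact Pd |]; intros x y Hx Hy X Y.
(* On the two lines through [(p, q)] the quotient says nothing, but both the double difference and
   the product of increments vanish. *)
destruct (classic (x = p \/ y = q)) as [E | N].
{ replace (ddiff (p, q) (x, y) F - f (p, q) * ((x - p) * (y - q))) with 0
    by (unfold ddiff; simpl; destruct E; subst; ring).
  rewrite Rabs_R0; apply Rmult_le_pos; [lra |].
  apply Rmult_le_pos; apply Rabs_pos. }
assert (N1 : x - p <> 0) by (intros E; apply N; left; lra).
assert (N2 : y - q <> 0) by (intros E; apply N; right; lra).
destruct (sign_exists _ N1) as [s Hs]. destruct (sign_exists _ N2) as [t Ht].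
replace (ddiff (p, q) (x, y) F - f (p, q) * ((x - p) * (y - q))) with
  ((dmean (p, q) (x, y) F - f (p, q)) * ((x - p) * (y - q)))
  by (unfold dmean; simpl; field; split; assumption).
rewrite !Rabs_mult; apply Rmult_le_compat_r.
{ apply Rmult_le_pos; apply Rabs_pos. }
apply Rlt_le, (Hd s t); simpl; try assumption.
split; split; simpl; lra.
Qed.

Theorem proposition34 (a b : point) (f : double_function)
  (Hab : dlt a b)
  (Hf : forall x : point, ddom f x <-> closed_dint a b x)
  (HF : exists F : double_function, is_double_primitive F f a b) :
  exists c : point,
    open_dint a b c /\
    double_newton_integral f a b = f c * (fst b - fst a) * (snd b - snd a).
Proof.
destruct HF as [F HF].
destruct (rect_mean_value (fun u v w z => ddiff (u, w) (v, z) F)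
  (fun p q => f (p, q)) (fst a) (fst b) (snd a) (snd b)) as [p [q [Hp [Hq E]]]].
- split; intros; unfold ddiff; simpl; ring.
- apply double_primitive_rect_derivative; exact HF.
- apply Hab.
- apply Hab.
- exists (p, q); split; [split; split; simpl; lra |].
  rewrite (double_newton_integralE F f a b Hab HF), Rmult_assoc, <- E.
  reflexivity.
Qed.
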